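(* Let $J$ be a Jordan algebra over a field $K$, let $V$ be a $K$-vector space with fixed basis $\{e_1,\dots,e_r\}$, and let $\theta,\eta\in Z^2(J,V)$, with $\theta(x,y)=\sum_{i=1}^r\theta_i(x,y)e_i$ and $\eta(x,y)=\sum_{i=1}^r\eta_i(x,y)e_i$, where $\theta_i,\eta_i\in Z^2(J,K)$. 1. The Jordan algebra $J_\theta$ is a step-$r$ descendant of $J$ if and only if $\theta^\perp\cap Z(J)=0$ and the image of the subspace $\langle\theta_1,\dots,\theta_r\rangle$ in $H^2(J,K)$ is $r$-dimensional. 2. Suppose that $J_\theta$ and $J_\eta$ are descendants of $J$. Then $J_\theta\cong J_\eta$ if and only if the images of the subspaces $\langle\theta_1,\dots,\theta_r\rangle$ and $\langle\eta_1,\dots,\eta_r\rangle$ in $H^2(J,K)$ are in the same orbit under the action of $\operatorname{Aut}(J)$.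
   Context: A Jordan algebra over a field $K$ is a $K$-vector space $J$ with a symmetric bilinear product $\circ$ satisfying $x^2\circ(x\circ y)=x\circ(x^2\circ y)$ for all $x,y$, where $x^2=x\circ x$. Its centre is $Z(J)=\{x\in J: x\circ y=0\ \forall y\in J\}$, and $J^2$ denotes the span of all products $x\circ y$. A Jordan algebra $\tilde J$ is a descendant of $J$ if $\tilde J/Z(\tilde J)\cong J$ and $Z(\tilde J)\subseteq \tilde J^2$; it is a step-$r$ descendant if moreover $\dim Z(\tilde J)=r$. For a vector space $V$, $Z^2(J,V)$ is the space of symmetric bilinear maps $\theta:J\times J\to V$ with $\theta(x^2,x\circ y)=\theta(x,x^2\circ y)$ for all $x,y\in J$. For a linear map $f:J\to V$, $(\delta f)(x,y)=f(x\circ y)$; these form the subspace $\delta C^1(J,V)\subseteq Z^2(J,V)$, and $H^2(J,V)=Z^2(J,V)/\delta C^1(J,V)$. The radical is $\theta^\perp=\{x\in J:\theta(x,y)=0\ \forall y\in J\}$. For $\theta\in Z^2(J,V)$, $J_\theta$ is the Jordan algebra on $J\oplus V$ with product $(x+v)\circ(y+w)=x\circ_J y+\theta(x,y)$ for $x,y\in J$, $v,w\in V$. $\operatorname{Aut}(J)$ acts by $(\phi\theta)(x,y)=\theta(\phi x,\phi y)$ on $Z^2(J,K)$, hence on $H^2(J,K)$ and on its subspaces.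
   Formalization: In part 2 it is additionally assumed that J is finite-dimensional or that both descendants are step-r (their centres have dimension r); for infinite-dimensional J and descendants with larger centre, part 2 as stated is false. *)

(* Defs.v *)
From HB Require Import structures.
From mathcomp Require Import all_boot all_order all_algebra.
From mathcomp Require Import all_classical.
Set Implicit Arguments.
Unset Strict Implicit.
Unset Printing Implicit Defensive.
Import GRing.Theory.
Local Open Scope classical_set_scope.
Local Open Scope ring_scope.
Local Open Scope quotient_scope.

Section LinearAlgebra.
Variables (K : fieldType) (M : lmodType K).

Definition lspan (A : set M) : set M :=
  [set x | exists n (c : 'I_n -> K) (v : 'I_n -> M),
     (forall i, A (v i)) /\ x = \sum_i c i *: v i].

Definition lfree n (b : 'I_n -> M) : Prop :=
  forall c : 'I_n -> K, \sum_i c i *: b i = 0 -> forall i, c i = 0.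

Definition has_dim (S : set M) (n : nat) : Prop :=
  exists b : 'I_n -> M, lfree b /\ lspan (range b) = S.

Definition findim : Prop := exists n, has_dim setT n.

End LinearAlgebra.
Arguments findim {K} M.

Section QuotientModule.
Variables (R : pzRingType) (M : lmodType R) (W : submodClosed M).

Fact submod_zmod_closed : zmod_closed W.
Proof. by split=> [|x y xW yW]; rewrite ?rpred0 // -scaleN1r rpredD ?rpredZ. Qed.

(* submodClosed is a structure over semimodules, which do not yield zmodClosed
   by inheritance. *)
Definition submod_zmod : zmodClosed M :=
  HB.pack (W : {pred M}) (GRing.isZmodClosed.Build M (W : {pred M}) submod_zmod_closed).

Definition lquot : Type := Quotient.quot submod_zmod.
HB.instance Definition _ := Choice.on lquot.
HB.instance Definition _ := GRing.Zmodule.on lquot.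
HB.instance Definition _ : EqQuotient M (Quotient.equiv submod_zmod) lquot :=
  EqQuotient.on lquot.
HB.instance Definition _ :=
  ZmodQuotient.on lquot.

Lemma lquotP (x y : M) : reflect (\pi_lquot x = \pi_lquot y) (x - y \in W).
Proof.
by rewrite [_ \in _](Quotient.idealrBE submod_zmod x y); exact: eqP.
Qed.

Lemma lquot_reprP (x : M) : repr (\pi_lquot x) - x \in W.
Proof. by apply/lquotP; rewrite reprK. Qed.

Definition lquot_scale (a : R) (u : lquot) : lquot := \pi_lquot (a *: repr u).

Lemma pi_lquot_scale a : {morph \pi_lquot : x / a *: x >-> lquot_scale a x}.
Proof.
move=> x; rewrite /lquot_scale; apply/esym/lquotP.
by rewrite -scalerBr rpredZ ?lquot_reprP.
Qed.

Lemma pi_lquotD : {morph \pi_lquot : x y / x + y >-> x + y}.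
Proof. exact: (raddfD (\pi_lquot : {additive M -> lquot})). Qed.

Let lquotW (P : lquot -> Prop) : (forall x, P (\pi_lquot x)) -> forall u, P u.
Proof. by move=> h u; rewrite -[u]reprK. Qed.

Fact lquot_scaleA a b u :
  lquot_scale a (lquot_scale b u) = lquot_scale (a * b) u.
Proof. by elim/lquotW: u => x; rewrite -!pi_lquot_scale scalerA. Qed.

Fact lquot_scale1 : left_id 1 lquot_scale.
Proof. by elim/lquotW=> x; rewrite -pi_lquot_scale scale1r. Qed.

Fact lquot_scaleDr : right_distributive lquot_scale +%R.
Proof.
move=> a; elim/lquotW=> x; elim/lquotW=> y.
by rewrite -!pi_lquot_scale -!pi_lquotD -pi_lquot_scale scalerDr.
Qed.

Fact lquot_scaleDl u : {morph lquot_scale^~ u : a b / a + b}.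
Proof.
by elim/lquotW: u => x a b; rewrite -!pi_lquot_scale -pi_lquotD scalerDl.
Qed.

HB.instance Definition _ := GRing.Zmodule_isLmodule.Build R lquot
  lquot_scaleA lquot_scale1 lquot_scaleDr lquot_scaleDl.

Lemma pi_lquot_linear : linear \pi_lquot.
Proof. by move=> a x y; rewrite pi_lquotD pi_lquot_scale. Qed.

End QuotientModule.

HB.mixin Record Lmodule_isJordan (K : fieldType) J & GRing.Lmodule K J := {
  jmul : J -> J -> J;
  jmulC : commutative jmul;
  jmulPl : forall y, linear (jmul^~ y);
  jordan_identity : forall x y,
    jmul (jmul x x) (jmul x y) = jmul x (jmul (jmul x x) y)
}.

#[short(type="jordanType")]
HB.structure Definition Jordan (K : fieldType) :=
  {J of GRing.Lmodule K J & Lmodule_isJordan K J}.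

Notation "x ∘ y" := (jmul x y) (at level 40, left associativity) : ring_scope.

Section JordanTheory.
Variables (K : fieldType) (J : jordanType K).

Lemma jmulDl (x y z : J) : (x + y) ∘ z = x ∘ z + y ∘ z.
Proof. by have := jmulPl z 1 x y; rewrite !scale1r. Qed.

Lemma jmul0l (z : J) : 0 ∘ z = 0.
Proof. by apply: (addrI (0 ∘ z)); rewrite -jmulDl !addr0. Qed.

Lemma jmulZl a (x z : J) : (a *: x) ∘ z = a *: (x ∘ z).
Proof. by have := jmulPl z a x 0; rewrite addr0 jmul0l addr0. Qed.

Definition jsquare : set J := lspan [set z | exists x y : J, z = x ∘ y].

Definition jcenter : set J := [set x | forall y, x ∘ y = 0].

Definition jcenterb : {pred J} := fun x => x \in jcenter.

Fact jcenterb_submod_closed : submod_closed jcenterb.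
Proof.
split=> [|a x y]; first by apply/mem_set => y; rewrite jmul0l.
move=> /set_mem xZ /set_mem yZ; apply/mem_set => z.
by rewrite jmulDl jmulZl xZ yZ scaler0 addr0.
Qed.
HB.instance Definition _ :=
  GRing.isSubmodClosed.Build K J jcenterb jcenterb_submod_closed.

Definition jquot : Type := lquot jcenterb.
HB.instance Definition _ := GRing.Lmodule.on jquot.

Definition jquot_mul (u v : jquot) : jquot :=
  \pi_(lquot jcenterb) (repr u ∘ repr v).

Lemma pi_jquot_mul (x y : J) :
  jquot_mul (\pi_(lquot jcenterb) x) (\pi_(lquot jcenterb) y)
  = \pi_(lquot jcenterb) (x ∘ y).
Proof.
have reprZ z t : repr (\pi_(lquot jcenterb) z) ∘ t = z ∘ t.
  have /set_mem/(_ t) := lquot_reprP jcenterb z.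
  by rewrite jmulDl -scaleN1r jmulZl scaleN1r => /subr0_eq.
by rewrite /jquot_mul reprZ jmulC reprZ jmulC.
Qed.

Let jquotW (P : jquot -> Prop) :
  (forall x, P (\pi_(lquot jcenterb) x)) -> forall u, P u.
Proof. by move=> h u; rewrite -[u]reprK. Qed.

Fact jquot_mulC : commutative jquot_mul.
Proof.
by elim/jquotW=> x; elim/jquotW=> y; rewrite !pi_jquot_mul jmulC.
Qed.

Fact jquot_mulPl v : linear (jquot_mul^~ v).
Proof.
elim/jquotW: v => z a; elim/jquotW=> x; elim/jquotW=> y.
by rewrite -pi_lquot_linear !pi_jquot_mul jmulPl pi_lquot_linear.
Qed.

Fact jquot_jordan u v : jquot_mul (jquot_mul u u) (jquot_mul u v)
  = jquot_mul u (jquot_mul (jquot_mul u u) v).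
Proof.
elim/jquotW: u => x; elim/jquotW: v => y.
by rewrite !pi_jquot_mul jordan_identity.
Qed.

HB.instance Definition _ := Lmodule_isJordan.Build K jquot
  jquot_mulC jquot_mulPl jquot_jordan.

End JordanTheory.
Arguments jsquare {K} J.
Arguments jcenter {K} J.
Arguments jcenterb {K} J.
Arguments jquot {K} J.

Definition jmorphism (K : fieldType) (J L : jordanType K) (f : J -> L) : Prop :=
  {morph f : x y / x ∘ y}.

Definition jisomorphic (K : fieldType) (J L : jordanType K) : Prop :=
  exists f : {linear J -> L}, bijective f /\ jmorphism f.

Record jaut (K : fieldType) (J : jordanType K) := JAut {
  jaut_fun :> {linear J -> J};
  jaut_bij : bijective jaut_fun;
  jautM : jmorphism jaut_fun
}.

(* L is a descendant of J. *)
Definition descendant (K : fieldType) (J L : jordanType K) : Prop :=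
  jisomorphic (jquot L) J /\ jcenter L `<=` jsquare L.

Definition step_descendant (K : fieldType) (r : nat) (J L : jordanType K) :=
  descendant J L /\ has_dim (jcenter L) r.

Section Cohomology.
Variables (K : fieldType) (J : jordanType K) (V : lmodType K).

Definition is_cocycle (t : J -> J -> V) : Prop :=
  [/\ forall x y, t x y = t y x,
      forall y, linear (t^~ y) &
      forall x y, t (x ∘ x) (x ∘ y) = t x ((x ∘ x) ∘ y)].

Definition cocycleb : {pred J -> J -> V} := fun t => `[< is_cocycle t >].

Fact cocycleb_submod_closed : submod_closed cocycleb.
Proof.
split=> [|a s t].
  by apply/asboolP; split=> // y b u v; rewrite scaler0 addr0.
move=> /asboolP[sC sL sJ] /asboolP[tC tL tJ]; apply/asboolP.
split=> [x y|y b u v|x y]; rewrite !fctE /=.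
- by rewrite sC tC.
- by rewrite sL tL !scalerDr !scalerA [a * b]mulrC addrACA.
- by rewrite sJ tJ.
Qed.
HB.instance Definition _ := GRing.isSubmodClosed.Build K (J -> J -> V)
  cocycleb cocycleb_submod_closed.

Record Z2 := MkZ2 { Z2_fun :> J -> J -> V; Z2_funP : Z2_fun \in cocycleb }.
HB.instance Definition _ := [isSub for Z2_fun].
HB.instance Definition _ := [Choice of Z2 by <:].
HB.instance Definition _ := [SubChoice_isSubLmodule of Z2 by <:].

Lemma Z2P (t : Z2) : is_cocycle t.
Proof. exact/asboolP/(Z2_funP t). Qed.

Definition is_coboundary (t : Z2) : Prop :=
  exists f : {linear J -> V}, forall x y, t x y = f (x ∘ y).

Definition coboundaryb : {pred Z2} := fun t => `[< is_coboundary t >].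

Fact coboundaryb_submod_closed : submod_closed coboundaryb.
Proof.
split=> [|a s t]; first by apply/asboolP; exists \0.
move=> /asboolP[f sf] /asboolP[g tg]; apply/asboolP.
by exists (a \*: f \+ g) => x y /=; rewrite -sf -tg.
Qed.
HB.instance Definition _ := GRing.isSubmodClosed.Build K Z2
  coboundaryb coboundaryb_submod_closed.

Definition H2 : Type := lquot coboundaryb.
HB.instance Definition _ := GRing.Lmodule.on H2.

Definition H2class (t : Z2) : H2 := \pi_(lquot coboundaryb) t.

Definition radical (t : J -> J -> V) : set J :=
  [set x | forall y, t x y = 0].

Lemma Z20l (t : Z2) x : t 0 x = 0.
Proof.
have [_ tL _] := Z2P t; have := tL x 1 0 0.
by rewrite !scale1r addr0 => /esym/(canRL (addrK _)); rewrite subrr.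
Qed.

Definition jext (t : Z2) : Type := (J * V)%type.

Section Extension.
Variable t : Z2.

HB.instance Definition _ := GRing.Lmodule.copy (jext t) (J * V)%type.

Definition jext_mul (p q : jext t) : jext t := (p.1 ∘ q.1, t p.1 q.1).

Fact jext_mulC : commutative jext_mul.
Proof. by move=> p q; rewrite /jext_mul jmulC (let: And3 h _ _ := Z2P t in h). Qed.

Fact jext_mulPl q : linear (jext_mul^~ q).
Proof.
by move=> a p p'; have [_ tL _] := Z2P t; rewrite /jext_mul /= jmulPl tL.
Qed.

Fact jext_jordan p q : jext_mul (jext_mul p p) (jext_mul p q)
  = jext_mul p (jext_mul (jext_mul p p) q).
Proof.
by have [_ _ tJ] := Z2P t; rewrite /jext_mul /= jordan_identity tJ.
Qed.

HB.instance Definition _ := Lmodule_isJordan.Build K (jext t)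
  jext_mulC jext_mulPl jext_jordan.
End Extension.

Section AutAction.
Variable phi : jaut J.

Fact autZ2_subproof (t : Z2) : (fun x y => t (phi x) (phi y)) \in cocycleb.
Proof.
have [tC tL tJ] := Z2P t; apply/asboolP; split=> [x y|y a u v|x y].
- exact: tC.
- by rewrite linearP tL.
- by rewrite !(jautM phi) tJ.
Qed.
Definition autZ2 (t : Z2) : Z2 := MkZ2 (autZ2_subproof t).

(* Defined through representatives; autH2E shows independence of the choice. *)
Definition autH2 (u : H2) : H2 :=
  H2class (autZ2 (repr (u : lquot coboundaryb))).

Lemma autH2E t : autH2 (H2class t) = H2class (autZ2 t).
Proof.
apply/lquotP/asboolP.
have /asboolP[f tf] := lquot_reprP coboundaryb t.
by exists (f \o phi) => x y /=; rewrite (jautM phi) -tf.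
Qed.
End AutAction.

End Cohomology.

Definition same_aut_orbit (K : fieldType) (J : jordanType K) (V : lmodType K)
    (S T : set (H2 J V)) : Prop :=
  exists phi : jaut J, autH2 phi @` S = T.

(* <t_1, ..., t_r> pushed to H^2(J, K); K^o is K as a K-vector space. *)
Definition H2span (K : fieldType) (J : jordanType K) r
    (t : 'I_r -> Z2 J K^o) : set (H2 J K^o) :=
  @H2class K J K^o @` lspan (range t).

(* Main.v *)
(* The centre of J_theta is the direct sum of V and of the part of Z(J) lying in
   the radical of theta, so it has dimension r exactly when the latter part is
   zero, and then it is V.  A linear form on J + V vanishing on all products
   amounts to a relation sum_i c_i theta_i = delta f; hence V is contained in the
   square of J_theta exactly when the classes of the theta_i are independent.
   An isomorphism J_eta -> J_theta preserves centres, so it is a block-triangular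
   map (x, v) |-> (phi x, f x + psi v); being multiplicative means that phi is an
   automorphism of J and theta(phi x, phi y) = f (x y) + psi (eta (x, y)).  In
   coordinates, each phi theta_i is a combination of the eta_j modulo
   coboundaries, and independence makes the two spans in H^2 equal.  When J is
   finite-dimensional, the centre of a descendant J_theta is V because the
   surjection J -> J_theta / Z(J_theta) ~ J must be injective. *)
Require Import Defs.
From HB Require Import structures.
From mathcomp Require Import all_boot all_order all_algebra.
From mathcomp Require Import all_classical.
Set Implicit Arguments.
Unset Strict Implicit.
Unset Printing Implicit Defensive.
Import GRing.Theory.
Local Open Scope classical_set_scope.
Local Open Scope ring_scope.

(** * Linear algebra over a field: spans, exchange, separating functionals *)

Section LinearMaps.
Variable K : fieldType.

Lemma linear_bundle (U W : lmodType K) (f : U -> W) :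
  linear f -> exists g : {linear U -> W}, g =1 f.
Proof.
move=> fL; pose mf := GRing.isLinear.Build K U W *:%R f fL.
by exists (HB.pack f mf : {linear U -> W}).
Qed.

Lemma linear_inverse (U W : lmodType K) (f : {linear U -> W}) :
  bijective f -> exists g : {linear W -> U}, cancel f g /\ cancel g f.
Proof.
move=> [g fK gK]; have gL : linear g.
  by move=> a x y; apply: (can_inj fK); rewrite linearP !gK.
by have [h hg] := linear_bundle gL; exists h; split=> x; rewrite hg.
Qed.

Lemma lcombM (M : lmodType K) m n (A : 'M[K]_(m, n)) (w : 'I_n -> M)
    (u : 'rV[K]_m) :
  \sum_i u 0 i *: (\sum_j A i j *: w j) = \sum_j (u *m A) 0 j *: w j.
Proof.
under eq_bigr => i _ do rewrite scaler_sumr.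
rewrite exchange_big; apply: eq_bigr => j _; rewrite mxE scaler_suml.
by apply: eq_bigr => i _; rewrite scalerA.
Qed.

Lemma lspan_rangeP (M : lmodType K) n (w : 'I_n -> M) x :
  lspan (range w) x <-> exists u : 'rV[K]_n, x = \sum_i u 0 i *: w i.
Proof.
split=> [[m [c [v [vw ->]]]]|[u ->]]; last first.
  by exists n, (u 0), w; split=> // i; exists i.
have /choice[k kv] i : exists j, w j = v i by have [j _ <-] := vw i; exists j.
(* [A] is the incidence matrix of [k]; multiplying by it collects the coefficients of vectors that
   occur several times. *)
pose A : 'M[K]_(m, n) := \matrix_(i, j) (j == k i)%:R.
exists ((\row_i c i) *m A); rewrite -lcombM; apply: eq_bigr => i _.
rewrite mxE (bigD1 (k i)) //= mxE eqxx scale1r kv big1 ?addr0 // => j /negPf ne.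
by rewrite mxE ne scale0r.
Qed.

Lemma lfreeP (M : lmodType K) n (b : 'I_n -> M) :
  lfree b <-> forall u : 'rV[K]_n, \sum_i u 0 i *: b i = 0 -> u = 0.
Proof.
split=> [bF u /bF u0|bF c c0 i]; first by apply/rowP => i; rewrite u0 mxE.
have /rowP/(_ i) : \row_j c j = 0 by apply: bF; under eq_bigr do rewrite mxE.
by rewrite !mxE.
Qed.

Section Exchange.
Variables (M : lmodType K) (n : nat) (b w : 'I_n -> M).

(** A row vector killed by [A] is a relation among the [b i], so [A] has trivial left kernel; being
    square, it is invertible. *)
Lemma lfree_unitmx (A : 'M[K]_n) :
  lfree b -> (forall i, b i = \sum_j A i j *: w j) -> A \in unitmx.
Proof.
move=> /lfreeP bF bA; rewrite -row_free_unit; apply: inj_row_free => u uA.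
apply: bF; under eq_bigr do rewrite bA.
by rewrite lcombM uA big1 // => i _; rewrite mxE scale0r.
Qed.

(** Steinitz exchange for families of equal size: the transition matrix is invertible, so
    coordinates pass both ways. *)
Lemma lfree_exchange : lfree b -> (forall i, lspan (range w) (b i)) ->
  lfree w /\ lspan (range b) = lspan (range w).
Proof.
move=> bF bw.
have /choice[a ba] i : exists u : 'rV[K]_n, b i = \sum_j u 0 j *: w j.
  exact/lspan_rangeP.
pose A := \matrix_i a i.
have bA i : b i = \sum_j A i j *: w j.
  by rewrite ba; apply: eq_bigr => j _; rewrite mxE.
have uA := lfree_unitmx bF bA.
have wb (u : 'rV[K]_n) : \sum_i u 0 i *: w i = \sum_i (u *m invmx A) 0 i *: b i.
  by under [RHS]eq_bigr do rewrite bA; rewrite lcombM mulmxKV.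
split.
  apply/lfreeP => u; rewrite wb => u0; apply: (can_inj (mulmxKV uA)).
  by rewrite mul0mx; move/lfreeP: bF; apply.
rewrite eqEsubset; split=> x /lspan_rangeP[u ->]; apply/lspan_rangeP.
  by exists (u *m A); rewrite -lcombM; apply: eq_bigr => i _; rewrite bA.
by exists (u *m invmx A); rewrite wb.
Qed.

End Exchange.

Lemma has_dim_span (M : lmodType K) n (w : 'I_n -> M) :
  has_dim (lspan (range w)) n <-> lfree w.
Proof.
split=> [[b [bF bw]]|wF]; last by exists w.
have [] // := @lfree_exchange M n b w bF => i.
by rewrite -bw; exists 1%N, (fun=> 1), (fun=> b i); split;
  [move=> _; exists i | rewrite big_ord1 scale1r].
Qed.

Lemma has_dim_lfree (M : lmodType K) (S : set M) n (w : 'I_n -> M) :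
  has_dim S n -> lfree w -> (forall i, S (w i)) -> S = lspan (range w).
Proof.
move=> [b [bF <-]] wF wS.
by have [_ ->] := lfree_exchange wF wS.
Qed.

(** Preimages of a basis are free, hence again a basis by exchange; [f] carries this basis to a free
    family, so its kernel is zero. *)
Lemma findim_surj_inj (M : lmodType K) (f : {linear M -> M}) :
  findim M -> (forall y, exists x, f x = y) -> injective f.
Proof.
move=> [n [b [bF bT]]] /choice[g gK].
have bP x : exists u : 'rV[K]_n, x = \sum_i u 0 i *: b i.
  by apply/lspan_rangeP; rewrite bT.
have sumf (u : 'rV[K]_n) (w : 'I_n -> M) :
  f (\sum_i u 0 i *: w i) = \sum_i u 0 i *: f (w i).
  by rewrite linear_sum; apply: eq_bigr => i _; rewrite linearZ.
have gF : lfree (g \o b).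
  apply/lfreeP => u /(congr1 f); rewrite (sumf u (g \o b)) linear0.
  by under eq_bigr do rewrite /= gK; move/lfreeP: bF; apply.
have [i|_ gT] := lfree_exchange gF (w := b); first exact/lspan_rangeP/bP.
suff f0 (x : M) : f x = 0 -> x = 0 by apply: raddf_inj.
have /lspan_rangeP[u xE] : lspan (range (g \o b)) x by rewrite gT bT.
rewrite xE sumf; under eq_bigr do rewrite /= gK.
move/lfreeP: bF => /[apply] ->.
by rewrite big1 // => i _; rewrite mxE scale0r.
Qed.

Definition subspace (M : lmodType K) (S : set M) :=
  S 0 /\ forall a x y, S x -> S y -> S (a *: x + y).

Lemma lspan_subspace (M : lmodType K) (A : set M) : subspace (lspan A).
Proof.
split=> [|a x y [n [c [v [vA ->]]]] [m [d [w [wA ->]]]]].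
  by exists 0%N, (fun=> 0), (fun=> 0); split=> [[]//|]; rewrite big_ord0.
exists (n + m)%N.
exists (fun i => match fintype.split i with inl j => a * c j | inr j => d j end).
exists (fun i => match fintype.split i with inl j => v j | inr j => w j end).
split=> [i|]; first by case: (fintype.split i).
rewrite big_split_ord scaler_sumr /=; congr (_ + _); apply: eq_bigr => i _.
  by case: split_ordP => j /eqP; rewrite ?eq_lshift ?eq_lrshift // => /eqP->;
     rewrite scalerA.
by case: split_ordP => j /eqP; rewrite ?eq_rshift ?eq_rlshift // => /eqP->.
Qed.

(* A subspace [H] maximal among those containing [S] but not [z] has codimension
   one, since adding any further vector to [H] captures [z]. *)
Lemma separating_functional (M : lmodType K) (S : set M) (z : M) :
  subspace S -> ~ S z ->
  exists g : {linear M -> K^o}, (forall x, S x -> g x = 0) /\ g z = 1.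
Proof.
move=> [S0 SP] Sz.
(* The union with [S] makes [P] hold for the empty set, which is the union of the empty chain in
   Zorn's lemma. *)
pose P (A : set M) := subspace (A `|` S) /\ ~ (A `|` S) z.
have [F FP Ftot|A [[[A0 AP] Az] Amax]] := @Zorn_bigcup M P.
  split=> [|[[B FB Bz]|//]]; last by have [_] := FP _ FB; apply; left.
  split=> [|a x y]; first by right.
  case=> [[B FB Bx]|Sx] [[C FC Cy]|Sy].
  - have [D [FD Dx Dy]] : exists D, [/\ F D, D x & D y].
      by have [BC|CB] := Ftot _ _ FB FC; [exists C | exists B];
        split=> //; [exact: BC | exact: CB].
    have [[_ DP] _] := FP _ FD.
    by case: (DP a x y) => // [||?|?]; [left|left|left; exists D|right].
  - have [[_ DP] _] := FP _ FB.
    by case: (DP a x y) => // [||?|?]; [left|right|left; exists B|right].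
  - have [[_ DP] _] := FP _ FC.
    by case: (DP a x y) => // [||?|?]; [right|left|left; exists C|right].
  - by right; apply: SP.
pose H := A `|` S.
have HB x y : H x -> H y -> H (x - y).
  by move=> Hx Hy; rewrite addrC -scaleN1r; apply: AP.
have HZ a x : H x -> H (a *: x) by move=> Hx; rewrite -[_ *: _]addr0; apply: AP.
have ex x : exists a, H (x - a *: z).
  have [Hx|Hx] := pselect (H x); first by exists 0; rewrite scale0r subr0.
  have [] := pselect ([set t | exists h a, H h /\ t = h + a *: x] z).
    move=> [h [a [Hh zE]]]; have a0 : a != 0.
      by apply: contra_notN Az => /eqP a0; rewrite zE a0 scale0r addr0.
    exists a^-1; rewrite zE scalerDr scalerA mulVf // scale1r opprD addrCA.
    by rewrite subrr addr0 -scaleN1r; exact/HZ/HZ.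
  (* [B] is the sum of [H] and the line through [x]. If it missed [z], it would satisfy [P] and
     strictly contain [A]. *)
  move=> nz; exfalso; pose B := [set t | exists h a, H h /\ t = h + a *: x].
  have HsB t : H t -> B t by move=> Ht; exists t, 0; rewrite scale0r addr0.
  have BS : B `|` S = B.
    by rewrite eqEsubset; split=> t; [case=> // St; apply: HsB; right | left].
  apply: (Amax B); last first.
    rewrite /P BS; split=> //; split=> [|a t t' [h [c [Hh ->]]] [h' [c' [Hh' ->]]]].
      by apply: HsB; right.
    exists (a *: h + h'), (a * c + c'); split; first exact: AP.
    by rewrite scalerDr scalerDl scalerA addrACA.
  split=> [t At|BA]; first by apply: HsB; left.
  apply: Hx; left; apply: BA; exists 0, 1; split; first by right.
  by rewrite scale1r add0r.
(* As [z] lies outside [H], the coefficient of [z] modulo [H] is unique; this makes the chosen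
   function [g] linear. *)
have uniqc a b x : H (x - a *: z) -> H (x - b *: z) -> a = b.
  move=> Ha Hb; apply/eqP; rewrite -subr_eq0; apply: contra_notT Az => ab.
  have := HB _ _ Hb Ha; rewrite opprB addrC addrA subrK -scalerBl => /(HZ (a - b)^-1).
  by rewrite scalerA mulVf // scale1r.
have /choice[g gP] := ex.
have gL : linear (g : M -> K^o).
  move=> a x y; apply: (uniqc _ _ (a *: x + y)) => //.
  have -> : a *: x + y - (a *: (g x : K^o) + g y) *: z
      = a *: (x - g x *: z) + (y - g y *: z).
    by rewrite scalerBr scalerDl scalerA opprD addrACA.
  exact: AP (gP _) (gP _).
have [f fg] := linear_bundle gL; exists f; split=> [x Sx|]; rewrite fg.
  by apply: (uniqc _ _ x); rewrite // scale0r subr0; right.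
by apply: (uniqc _ _ z); rewrite // scale1r subrr; right.
Qed.

End LinearMaps.

Section Jordan.
Variable K : fieldType.

(** * Isomorphisms of Jordan algebras *)

Section Isomorphisms.
Variables (J L : jordanType K) (f : {linear J -> L}).

Lemma jmorphism_can (g : {linear L -> J}) :
  cancel f g -> cancel g f -> jmorphism f -> jmorphism g.
Proof. by move=> fK gK fM x y; apply: (can_inj fK); rewrite fM !gK. Qed.

Lemma jcenter_iso x : bijective f -> jmorphism f ->
  jcenter J x -> jcenter L (f x).
Proof. by move=> [g fK gK] fM xZ y; rewrite -[y]gK -fM xZ linear0. Qed.

End Isomorphisms.

Lemma jisomorphic_sym (J L : jordanType K) : jisomorphic J L -> jisomorphic L J.
Proof.
move=> [f [/linear_inverse[g [fK gK]] fM]].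
by exists g; split; [exists f | apply: jmorphism_can fM].
Qed.

(** * Linear structure of cohomology and the action of automorphisms *)

Section Cohomology.
Variables (J : jordanType K) (V : lmodType K).

HB.instance Definition _ := GRing.isLinear.Build K (Z2 J V) (H2 J V) *:%R
  (@H2class K J V) (pi_lquot_linear (@coboundaryb K J V)).

Lemma H2class_eq0 (t : Z2 J V) : H2class t = 0 <-> is_coboundary t.
Proof.
rewrite -(linear0 (@H2class K J V)) -[t in is_coboundary t]subr0.
split=> [/(lquotP (@coboundaryb K J V))/asboolP //|cob].
exact/(lquotP (@coboundaryb K J V))/asboolP.
Qed.

Lemma Z2_sumE n (u : 'rV[K]_n) (t : 'I_n -> Z2 J V) x y :
  (\sum_i u 0 i *: t i) x y = \sum_i u 0 i *: t i x y.
Proof.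
have -> : Z2_fun (\sum_i u 0 i *: t i) = \sum_i u 0 i *: Z2_fun (t i).
  exact: (raddf_sum (val : {additive Z2 J V -> (J -> J -> V)})).
by rewrite !fct_sumE.
Qed.

Section Automorphism.
Variable phi : jaut J.

Lemma autH2_linear : linear (@autH2 K J V phi).
Proof.
move=> a u v; rewrite -[u](reprK (u : lquot (@coboundaryb K J V))).
rewrite -[v](reprK (v : lquot (@coboundaryb K J V))).
rewrite -!/(H2class _) -linearP !autH2E -linearP; congr H2class.
exact: val_inj.
Qed.
HB.instance Definition _ := GRing.isLinear.Build K (H2 J V) (H2 J V) *:%R
  (@autH2 K J V phi) autH2_linear.

(** If [phi] turns a cocycle into the coboundary of [f], the cocycle itself is the coboundary of [f]
    composed with the inverse of [phi]. *)
Lemma autH2_eq0 (u : H2 J V) : autH2 phi u = 0 -> u = 0.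
Proof.
rewrite -[u](reprK (u : lquot (@coboundaryb K J V))) -!/(H2class _) autH2E.
move=> /H2class_eq0[f uf]; apply/H2class_eq0.
have [g [phiK gK]] := linear_inverse (jaut_bij phi).
have gM := jmorphism_can phiK gK (jautM phi).
exists (f \o g) => x y /=; rewrite gM -uf /=.
by rewrite !gK.
Qed.

End Automorphism.

End Cohomology.

Lemma linear_lspan (M N : lmodType K) (f : {linear M -> N}) n (w : 'I_n -> M) :
  f @` lspan (range w) = lspan (range (f \o w)).
Proof.
have sumf (u : 'rV[K]_n) : f (\sum_i u 0 i *: w i) = \sum_i u 0 i *: f (w i).
  by rewrite linear_sum; apply: eq_bigr => i _; rewrite linearZ.
rewrite eqEsubset; split=> [_ [_ /lspan_rangeP[u ->] <-]|_ /lspan_rangeP[u ->]].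
  by apply/lspan_rangeP; exists u; rewrite sumf.
by exists (\sum_i u 0 i *: w i); [apply/lspan_rangeP; exists u | rewrite sumf].
Qed.

Lemma H2spanE (J : jordanType K) r (t : 'I_r -> Z2 J K^o) :
  H2span t = lspan (range (@H2class K J K^o \o t)).
Proof. exact: linear_lspan. Qed.

(** Products in [jext t] ignore the [V] components, so testing against the pairs [(y, 0)]
    suffices. *)
Lemma jcenter_jext (J : jordanType K) (V : lmodType K) (t : Z2 J V)
    (p : jext t) :
  jcenter (jext t) p <-> (radical t `&` jcenter J) p.1.
Proof.
split=> [pZ|[pR pZ] q]; last by congr (_, _); [apply: pZ | apply: pR].
by split=> y; have [] := pZ (y, 0).
Qed.

(** * Coordinates in [V] with respect to [e] *)

Section Extension.
Variables (J : jordanType K) (V : vectType K) (r : nat) (e : r.-tuple V).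
Hypothesis he : basis_of fullv e.

Definition rvec (v : V) : 'rV[K]_r := \row_i coord e i v.
Definition vecr (u : 'rV[K]_r) : V := \sum_i u 0 i *: tnth e i.

Lemma vecrK : cancel vecr rvec.
Proof.
move=> u; apply/rowP => i; rewrite mxE /vecr.
under eq_bigr do rewrite (tnth_nth 0).
by rewrite coord_sum_free ?(basis_free he).
Qed.

Lemma rvecK : cancel rvec vecr.
Proof.
move=> v; rewrite [RHS](coord_basis he (memvf v)); apply: eq_bigr => i _.
by rewrite mxE (tnth_nth 0).
Qed.

Lemma rvec_is_linear : linear rvec.
Proof. by move=> a u v; apply/rowP => i; rewrite !mxE linearP. Qed.
HB.instance Definition _ := GRing.isLinear.Build K V 'rV[K]_r *:%R
  rvec rvec_is_linear.

Lemma vecr_is_linear : linear vecr.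
Proof.
move=> a u v; rewrite /vecr scaler_sumr -big_split; apply: eq_bigr => i _ /=.
by rewrite !mxE scalerDl scalerA.
Qed.
HB.instance Definition _ := GRing.isLinear.Build K 'rV[K]_r V *:%R
  vecr vecr_is_linear.

(** * Centre, central quotient and square of one extension *)

Section Cocycle.
Variables (t : Z2 J V) (t_ : 'I_r -> Z2 J K^o).
Hypothesis ht : forall x y, t x y = \sum_i (t_ i x y : K) *: tnth e i.

Lemma rvec_cocycle x y i : rvec (t x y) 0 i = t_ i x y.
Proof.
have -> : t x y = vecr (\row_j (t_ j x y : K)).
  by rewrite ht; apply: eq_bigr => j _; rewrite mxE.
by rewrite vecrK mxE.
Qed.

Let w i : jext t := (0, tnth e i).

Let sumw (u : 'rV[K]_r) : \sum_i u 0 i *: w i = (0, vecr u) :> jext t.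
Proof.
pose inr2 (v : V) : jext t := (0, v).
have inr2L : linear inr2.
  by move=> a u' v'; congr (_, _); rewrite /= scaler0 addr0.
have [f fE] := linear_bundle inr2L.
rewrite -/(inr2 _) -fE linear_sum; apply: eq_bigr => i _.
by rewrite linearZ fE.
Qed.

Let w_free : lfree w.
Proof.
apply/lfreeP => u; rewrite sumw => -[u0].
by rewrite -[u]vecrK u0 linear0.
Qed.

(** The copy of [V] is always central and [w] is a free family of [r] vectors spanning it; a centre
    of dimension [r] can contain nothing more. *)
Lemma has_dim_jcenter :
  has_dim (jcenter (jext t)) r <-> radical t `&` jcenter J = [set 0].
Proof.
have wP p : lspan (range w) p <-> p.1 = 0.
  split=> [/lspan_rangeP[u]|p0]; first by rewrite sumw => ->.
  by apply/lspan_rangeP; exists (rvec p.2); rewrite sumw rvecK -p0; case: p {p0}.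
have Z0 : (radical t `&` jcenter J) 0.
  by split=> y; rewrite ?Z20l ?jmul0l.
split=> [Zr|Z00].
  have Zw := has_dim_lfree Zr w_free (fun i => (jcenter_jext (w i)).2 Z0).
  rewrite eqEsubset; split=> [x xZ|_ ->//].
  by have /jcenter_jext : (radical t `&` jcenter J) (x, 0 : V).1 := xZ;
    rewrite Zw => /wP.
exists w; split=> //; rewrite eqEsubset; split=> p.
  by move=> /wP p0; apply/jcenter_jext; rewrite p0.
by move=> /jcenter_jext; rewrite Z00 => /wP.
Qed.

Hypothesis tZ : radical t `&` jcenter J = [set 0].

Lemma jcenter_jextE (p : jext t) : jcenter (jext t) p <-> p.1 = 0.
Proof. by rewrite jcenter_jext tZ. Qed.

(** The first projection has kernel [V], which is the centre under [tZ], so it induces the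
    isomorphism. *)
Lemma jquot_jext : jisomorphic (jquot (jext t)) J.
Proof.
pose pi : jext t -> jquot (jext t) := \pi_(lquot (jcenterb (jext t)))%qT.
pose f (u : jquot (jext t)) : J := (repr (u : lquot (jcenterb (jext t)))).1.
have f_pi p : f (pi p) = p.1.
  have /set_mem/jcenter_jextE := lquot_reprP (jcenterb (jext t)) p.
  exact: subr0_eq.
have fL : linear f.
  move=> a u v; rewrite -[u](reprK (u : lquot (jcenterb (jext t)))).
  rewrite -[v](reprK (v : lquot (jcenterb (jext t)))).
  by rewrite -pi_lquot_linear -!/(pi _) !f_pi.
have [g gf] := linear_bundle fL; exists g; split.
  exists (fun x => pi (x, 0)) => [u|x]; rewrite gf ?f_pi //.
  rewrite -[RHS](reprK (u : lquot (jcenterb (jext t)))).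
  apply/(lquotP (jcenterb (jext t)))/mem_set/jcenter_jextE.
  exact: subrr.
by move=> u v; rewrite !gf f_pi.
Qed.

(* If some central [z] lies outside [jsquare (jext t)], a functional vanishing
   on [jsquare (jext t)] but not at [z] splits into a linear form on [J] and
   coefficients on [e], exhibiting a dependency between the classes. *)
Lemma jcenter_sub_jsquare :
  jcenter (jext t) `<=` jsquare (jext t) <-> lfree (@H2class K J K^o \o t_).
Proof.
have cob (u : 'rV[K]_r) : \sum_i u 0 i *: H2class (t_ i) = 0 <->
    exists f : {linear J -> K^o}, forall x y,
      \sum_i u 0 i * (t_ i x y : K) = f (x ∘ y).
  rewrite -[X in X = 0](_ : H2class (\sum_i u 0 i *: t_ i) = _); last first.
    by rewrite linear_sum; apply: eq_bigr => i _; rewrite linearZ.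
  rewrite H2class_eq0; split=> -[f fE]; exists f => x y.
    by rewrite -fE Z2_sumE.
  by rewrite Z2_sumE; apply: fE.
split=> [ZS|tF].
  apply/lfreeP => u /cob[f fE].
  (* The relation [u] makes [g] vanish on products, hence on the centre by [ZS]; its value at [w i]
     is minus the [i]-th entry of [u]. *)
  pose g (p : jext t) : K^o := f p.1 - \sum_i u 0 i * rvec p.2 0 i.
  have gL : linear g.
    move=> a p q; rewrite /g /= !linearP /= scalerBr addrACA.
    congr (_ + _); rewrite -opprD; congr (- _).
    rewrite scaler_sumr -big_split; apply: eq_bigr => i _ /=.
    by rewrite !mxE mulrDr mulrCA.
  have [h hg] := linear_bundle gL.
  have hS p : jsquare (jext t) p -> h p = 0.
    move=> [n [c [v [vS ->]]]]; rewrite linear_sum big1 // => i _.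
    rewrite linearZ; have [x [y ->]] := vS i.
    rewrite hg /g /= -fE -sumrB big1 ?scaler0 // => j _.
    by rewrite rvec_cocycle subrr.
  apply/rowP => i; have : h (w i) = 0.
    exact/hS/ZS/jcenter_jextE.
  rewrite hg /g /= linear0 sub0r => /eqP; rewrite oppr_eq0 => /eqP.
  have -> : tnth e i = vecr (delta_mx 0 i).
    rewrite /vecr (bigD1 i) //= mxE !eqxx scale1r big1 ?addr0 // => j /negPf ne.
    by rewrite mxE ne andbF scale0r.
  rewrite vecrK (bigD1 i) //= big1 => [|j /negPf ne].
    by rewrite !mxE !eqxx mulr1 addr0.
  by rewrite mxE ne andbF mulr0.
move=> z /jcenter_jextE z0; apply: contrapT => zS.
have [g [gS gz]] := separating_functional (lspan_subspace _) zS.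
pose u : 'rV[K]_r := \row_i g (w i).
have gw v : g (0, v) = \sum_i u 0 i * rvec v 0 i.
  rewrite -[v in LHS]rvecK -sumw linear_sum; apply: eq_bigr => i _.
  by rewrite linearZ [u 0 i]mxE mulrC.
have u0 : u = 0.
  move/lfreeP: tF; apply; apply/cob.
  (* [g] kills [(x ∘ y, t x y)], so its [V] part, evaluated on the cocycle, is minus its [J] part on
     [x ∘ y]. This exhibits the combination with coefficients [u] as a coboundary. *)
  pose f (x : J) : K^o := - g ((x, 0) : jext t).
  have fL : linear f.
    move=> a x y; rewrite /f scalerN -opprD -linearP; congr (- g (_, _)).
    by rewrite /= scaler0 addr0.
  have [h hf] := linear_bundle fL; exists h => x y; rewrite hf.
  under eq_bigr do rewrite -rvec_cocycle.
  rewrite -gw; apply/eqP; rewrite -addr_eq0 -linearD; apply/eqP/gS.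
  exists 1%N, (fun=> 1), (fun=> ((x, 0) : jext t) ∘ (y, 0)); split=> [_|].
    by exists (x, 0), (y, 0).
  rewrite big_ord1 scale1r; congr (_, _); first exact: add0r.
  exact: addr0.
move/eqP: gz; case: z {zS} z0 => x v /= ->; rewrite gw u0 big1 => [|i _].
  by rewrite eq_sym oner_eq0.
by rewrite mxE mul0r.
Qed.

End Cocycle.

(** Since [V] is central, [x] mapped to the class of [(x, 0)] is already onto the quotient, so [h]
    is surjective and therefore injective. If [x] lies in the intersection, [(x, 0)] is central and
    [h x] is zero. *)
Lemma radical_jcenter_findim (t : Z2 J V) :
  findim J -> descendant J (jext t) -> radical t `&` jcenter J = [set 0].
Proof.
move=> Jfin [[f [[g fK gK] _]] _].
pose pi : jext t -> jquot (jext t) := \pi_(lquot (jcenterb (jext t)))%qT.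
have pi_eq p q : jcenter (jext t) (p - q) -> pi p = pi q.
  by move=> pqZ; apply/(lquotP (jcenterb (jext t)))/mem_set.
have h_lin : linear (fun x => f (pi (x, 0))).
  move=> a x y; rewrite -linearP -pi_lquot_linear; congr (f (pi (_, _))).
  by rewrite /= scaler0 addr0.
have [h hE] := linear_bundle h_lin.
have h_inj : injective h.
  apply: findim_surj_inj => // y.
  have [p gy] : exists p, pi p = g y.
    by exists (repr (g y : lquot (jcenterb (jext t)))); apply: reprK.
  exists p.1; rewrite hE -[RHS]gK -gy; congr (f _); apply: pi_eq.
  by apply/jcenter_jext; rewrite /= subrr; split=> z; rewrite ?Z20l ?jmul0l.
rewrite eqEsubset; split=> [x xZ|_ ->].
  apply: h_inj; rewrite !hE; congr (f _); apply/pi_eq/jcenter_jext.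
  by rewrite /= subr0.
by split=> z; rewrite ?Z20l ?jmul0l.
Qed.

(** * Isomorphisms of two extensions versus orbits in cohomology *)

Section Comparison.
Variables (theta eta : Z2 J V) (theta_ eta_ : 'I_r -> Z2 J K^o).
Hypothesis htheta :
  forall x y, theta x y = \sum_i (theta_ i x y : K) *: tnth e i.
Hypothesis heta : forall x y, eta x y = \sum_i (eta_ i x y : K) *: tnth e i.
Hypothesis theta_free : lfree (@H2class K J K^o \o theta_).

Let autH2_free (phi : jaut J) :
  lfree (autH2 phi \o (@H2class K J K^o \o theta_)).
Proof.
apply/lfreeP => u u0; move/lfreeP: theta_free; apply.
apply: (@autH2_eq0 J K^o phi); rewrite linear_sum -[RHS]u0.
by apply: eq_bigr => i _; rewrite linearZ.
Qed.

(** Lifts a matrix relation between classes to an identity of cocycles with an explicit coboundary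
    term. *)
Let autH2_spanP (phi : jaut J) (B : 'M[K]_r) i :
  autH2 phi (H2class (theta_ i)) = \sum_j B i j *: H2class (eta_ j) <->
  exists f : {linear J -> K^o}, forall x y,
    theta_ i (phi x) (phi y) = f (x ∘ y) + \sum_j B i j * (eta_ j x y : K).
Proof.
have -> : \sum_j B i j *: H2class (eta_ j)
    = H2class (\sum_j row i B 0 j *: eta_ j).
  rewrite linear_sum; apply: eq_bigr => j _.
  by rewrite linearZ mxE.
have sumE x y : \sum_j B i j * (eta_ j x y : K)
    = (\sum_j row i B 0 j *: eta_ j) x y.
  by rewrite Z2_sumE; apply: eq_bigr => j _; rewrite mxE.
rewrite autH2E; set s := \sum_j _ in sumE *.
have eqE : H2class (autZ2 phi (theta_ i)) = H2class s <->
    is_coboundary (autZ2 phi (theta_ i) - s).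
  rewrite -H2class_eq0 linearB /=; split=> [->|/subr0_eq//].
  exact: subrr.
split=> [/eqE|] -[f fE]; last apply/eqE; exists f => x y.
  by rewrite -fE sumE subrK.
have -> : (autZ2 phi (theta_ i) - s) x y = theta_ i (phi x) (phi y) - s x y.
  by [].
by rewrite fE sumE addrK.
Qed.

Lemma jext_iso_of_orbit :
  same_aut_orbit (H2span theta_) (H2span eta_) ->
  jisomorphic (jext eta) (jext theta).
Proof.
move=> [phi]; rewrite !H2spanE linear_lspan => phi_span.
have /choice[b bP] i : exists u : 'rV[K]_r,
    autH2 phi (H2class (theta_ i)) = \sum_j u 0 j *: H2class (eta_ j).
  apply/(lspan_rangeP (@H2class K J K^o \o eta_)); rewrite -phi_span.
  by exists 1%N, (fun=> 1), (fun=> autH2 phi (H2class (theta_ i))); split;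
    [move=> _; exists i | rewrite big_ord1 scale1r].
pose B := \matrix_i b i.
have BP i : autH2 phi (H2class (theta_ i)) = \sum_j B i j *: H2class (eta_ j).
  by rewrite bP; apply: eq_bigr => j _; rewrite mxE.
(* The transpose appears because [rvec] gives row vectors while the rows of [B] are indexed by
   [theta_]. *)
have uB : B^T \in unitmx.
  rewrite unitmx_tr.
  exact: (lfree_unitmx (w := @H2class K J K^o \o eta_) (@autH2_free phi) BP).
have /choice[f fP] i := (autH2_spanP phi B i).1 (BP i).
pose F x := vecr (\row_i f i x).
have F_lin : linear F.
  move=> a x y; rewrite /F -linearP; congr vecr.
  by apply/rowP => i; rewrite !mxE linearP.
have [phi' [phiK phi'K]] := linear_inverse (jaut_bij phi).
(* Block-triangular map: [phi] on [J], [B^T] on the coordinates of [V], and the coboundary terms [F]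
   from [J] to [V]. *)
pose alpha (p : jext eta) : jext theta :=
  (phi p.1, vecr (rvec p.2 *m B^T) + F p.1).
have alpha_lin : linear alpha.
  move=> a p q; rewrite /alpha /= linearP F_lin; congr (_, _).
  rewrite /= scalerDr addrACA; congr (_ + _).
  by rewrite linearP mulmxDl -scalemxAl linearP.
have [g gE] := linear_bundle alpha_lin; exists g; split.
  exists (fun q => (phi' q.1, vecr (rvec (q.2 - F (phi' q.1)) *m invmx B^T))).
    by move=> [x v]; rewrite gE /alpha /= phiK addrK vecrK mulmxK ?rvecK.
  by move=> [x v]; rewrite gE /alpha /= phi'K vecrK mulmxKV ?rvecK ?subrK.
move=> p q; rewrite !gE; congr (_, _); first exact: jautM.
rewrite /= -[RHS](rvecK (theta _ _)) -linearD; congr vecr.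
(* In the [i]-th coordinate, multiplicativity is exactly the relation [fP]. *)
apply/rowP => i; rewrite (rvec_cocycle htheta) fP addrC !mxE; congr (_ + _).
by apply: eq_bigr => j _; rewrite (rvec_cocycle heta) mxE mulrC.
Qed.

Hypothesis thetaZ : radical theta `&` jcenter J = [set 0].
Hypothesis etaZ : radical eta `&` jcenter J = [set 0].

Lemma orbit_of_jext_iso :
  jisomorphic (jext eta) (jext theta) ->
  same_aut_orbit (H2span theta_) (H2span eta_).
Proof.
move=> [alpha [alpha_bij alphaM]].
have [beta [alphaK betaK]] := linear_inverse alpha_bij.
(* Both centres are the copies of [V], so [alpha] and [beta] exchange these copies; hence their [J]
   blocks are mutually inverse. *)
have betaM := jmorphism_can alphaK betaK alphaM.
have beta_bij : bijective beta by exists alpha.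
have alphaZ p : p.1 = 0 -> (alpha p).1 = 0.
  by move=> /(jcenter_jextE etaZ)/(jcenter_iso alpha_bij alphaM)
    /(jcenter_jextE thetaZ).
have betaZ p : p.1 = 0 -> (beta p).1 = 0.
  by move=> /(jcenter_jextE thetaZ)/(jcenter_iso beta_bij betaM)
    /(jcenter_jextE etaZ).
pose inl1 (t : Z2 J V) (x : J) : jext t := (x, 0).
pose inr1 (t : Z2 J V) (v : V) : jext t := (0, v).
have inl_lin t : linear (inl1 t).
  by move=> a x y; congr (_, _); rewrite /= scaler0 addr0.
have inr_lin t : linear (inr1 t).
  by move=> a x y; congr (_, _); rewrite /= scaler0 addr0.
have split_jext t (p : jext t) : p = inl1 t p.1 + inr1 t p.2.
  by case: p => x v; congr (_, _); rewrite /= ?addr0 ?add0r.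
have f_lin : linear (fun x => (alpha (inl1 eta x)).1).
  by move=> a x y; rewrite inl_lin linearP.
have [f fE] := linear_bundle f_lin.
have fK : cancel f (fun y => (beta (inl1 theta y)).1).
  move=> x; rewrite fE.
  have := alphaK (inl1 eta x); rewrite [alpha _ in LHS]split_jext linearD.
  by move=> /(congr1 fst) /=; rewrite [X in _ + X]betaZ ?addr0.
have Kf : cancel (fun y => (beta (inl1 theta y)).1) f.
  move=> x; rewrite fE.
  have := betaK (inl1 theta x); rewrite [beta _ in LHS]split_jext linearD.
  by move=> /(congr1 fst) /=; rewrite [X in _ + X]alphaZ ?addr0.
(* The [J] component of this identity makes [f] multiplicative; the [V] component relates the two
   cocycles. *)
have alpha_mul x y : alpha (inl1 eta (x ∘ y)) + alpha (inr1 eta (eta x y))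
    = alpha (inl1 eta x) ∘ alpha (inl1 eta y).
  by rewrite -alphaM -linearD; congr (alpha _); rewrite [RHS]split_jext.
have fM : jmorphism f.
  move=> x y; rewrite !fE; have := congr1 fst (alpha_mul x y).
  by rewrite /= [X in _ + X]alphaZ ?addr0.
pose phi := JAut (Bijective fK Kf) fM; exists phi.
(* Column [j] holds the coordinates of the image of the [j]-th basis vector under the [V] block of
   [alpha]. *)
pose B := \matrix_(i, j) rvec (alpha (inr1 eta (tnth e j))).2 0 i.
have BP i : autH2 phi (H2class (theta_ i)) = \sum_j B i j *: H2class (eta_ j).
  apply/autH2_spanP.
  have h_lin : linear ((fun x => rvec (alpha (inl1 eta x)).2 0 i) : J -> K^o).
    by move=> a x y; rewrite inl_lin linearP /= linearP !mxE.
  have k_lin : linear ((fun v => rvec (alpha (inr1 eta v)).2 0 i) : V -> K^o).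
    by move=> a v v'; rewrite inr_lin linearP /= linearP !mxE.
  have [k kE] := linear_bundle k_lin.
  have [h hE] := linear_bundle h_lin; exists h => x y; rewrite hE.
  rewrite -(rvec_cocycle htheta) /phi /= !fE.
  have /(congr1 (fun p => rvec p.2 0 i)) := alpha_mul x y.
  rewrite /= linearD mxE => <-; congr (_ + _).
  rewrite -[LHS](kE (eta x y)) -[eta x y]rvecK linear_sum.
  apply: eq_bigr => j _; rewrite linearZ (rvec_cocycle heta) kE [B i j]mxE.
  exact: mulrC.
rewrite !H2spanE linear_lspan.
(* [BP] gives one inclusion of spans; the [r] transported classes are free, so exchange gives
   equality. *)
have [|_ //] := lfree_exchange (@autH2_free phi) (w := @H2class K J K^o \o eta_).
by move=> i; apply/lspan_rangeP; exists (row i B); rewrite /= BP;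
  apply: eq_bigr => j _; rewrite [row i B 0 j]mxE.
Qed.

End Comparison.
End Extension.
End Jordan.

Theorem theorem27 (K : fieldType) (J : jordanType K) (V : vectType K) (r : nat)
    (e : r.-tuple V) (he : basis_of fullv e)
    (theta eta : Z2 J V) (theta_ eta_ : 'I_r -> Z2 J K^o)
    (htheta : forall x y : J,
       theta x y = \sum_(i < r) (theta_ i x y : K) *: tnth e i)
    (heta : forall x y : J,
       eta x y = \sum_(i < r) (eta_ i x y : K) *: tnth e i) :
  (step_descendant r J (jext theta) <->
     radical theta `&` jcenter J = [set 0] /\ has_dim (H2span theta_) r)
  /\
  (findim J \/ (has_dim (jcenter (jext theta)) r /\
                has_dim (jcenter (jext eta)) r) ->
   descendant J (jext theta) -> descendant J (jext eta) ->
   (jisomorphic (jext theta) (jext eta) <->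
      same_aut_orbit (H2span theta_) (H2span eta_))).
Proof.
split; rewrite H2spanE.
  rewrite has_dim_span /step_descendant (has_dim_jcenter he).
  split=> [[[_ Zsub] Z0]|[Z0 tF]].
    by split=> //; apply/(jcenter_sub_jsquare he htheta Z0).
  split=> //; split; first exact: jquot_jext.
  exact/(jcenter_sub_jsquare he htheta Z0).
rewrite -H2spanE => Zdim tD eD.
(* Either alternative of [Zdim] forces both centres to be the copies of [V]. *)
have [tZ eZ] : radical theta `&` jcenter J = [set 0] /\
               radical eta `&` jcenter J = [set 0].
  case: Zdim => [Jfin|[]]; last by rewrite !(has_dim_jcenter he).
  by split; apply: radical_jcenter_findim.
have tF := (jcenter_sub_jsquare he htheta tZ).1 tD.2.
(* The isomorphism is reversed because a map from [jext eta] to [jext theta] is what expresses the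
   transported [theta_] through [eta_]. *)
split=> [/jisomorphic_sym|orb].
  exact: (orbit_of_jext_iso he htheta heta).
exact/jisomorphic_sym/(jext_iso_of_orbit he htheta heta).
Qed.
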